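(* Let $n$ (molar density) and $T$ (absolute temperature) be sufficiently smooth scalar fields with $0<n<1/b$ and $T>0$, and let the chemical potential $\mu$, the pressure $p$, the influence parameter $c=c(T)$ and the quantity $\gamma$ be defined from $n$ and $T$ as in the context. Then the gradients of pressure, temperature and chemical potential satisfy $$n\nabla\mu-\gamma\nabla T=\nabla p+\nabla\cdot\big(c\,(\nabla n\otimes\nabla n)\big).$$
   Context: Constants: gas constant $R>0$, critical temperature $T_c>0$, critical pressure $P_c>0$, acentric factor $\omega$, reference values $T_0=298.15$ K, $P_0=1$ bar, $\vartheta_0=-2478.95687512$ J/mol, and heat capacity coefficients $\alpha_0,\dots,\alpha_3$. Put $T_r=T/T_c$, $\psi_p(T)=\sum_{i=0}^3\alpha_iT^i$, $$a(T)=0.45724\frac{R^2T_c^2}{P_c}\big[1+m(1-\sqrt{T_r})\big]^2,\qquad b=0.07780\frac{RT_c}{P_c},$$ where $m=0.37464+1.54226\omega-0.26992\omega^2$ if $\omega\le 0.49$ and $m=0.379642+1.485030\omega-0.164423\omega^2+0.016666\omega^3$ if $\omega>0.49$. Bulk (Peng-Robinson) Helmholtz free energy density: $f_b(n,T)=f_b^{\mathrm{ideal}}+f_b^{\mathrm{repulsion}}+f_b^{\mathrm{attraction}}$ with $$f_b^{\mathrm{ideal}}=n\vartheta_0+n\sum_{i=0}^3\alpha_i\frac{T^{i+1}-T_0^{i+1}}{i+1}-nR(T-T_0)-nRT\ln\Big(\frac{P_0}{nRT}\Big)-nT\int_{T_0}^T\frac{\psi_p(\tau)}{\tau}d\tau,$$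 $$f_b^{\mathrm{repulsion}}=-nRT\ln(1-bn),\qquad f_b^{\mathrm{attraction}}=\frac{a(T)n}{2\sqrt2\,b}\ln\Big(\frac{1+(1-\sqrt2)bn}{1+(1+\sqrt2)bn}\Big).$$ Influence parameter: $c(T)=a(T)b^{2/3}[\beta_1(1-T_r)+\beta_2]$, $\beta_1=-\frac{10^{-16}}{1.2326+1.3757\omega}$, $\beta_2=\frac{10^{-16}}{0.9051+1.5410\omega}$. Definitions: $\mu_b=\partial f_b/\partial n$, $\mu=\mu_b-\nabla\cdot(c\nabla n)$; $\gamma_b=\partial f_b/\partial T$, $\gamma_\nabla=\frac12c'(T)|\nabla n|^2$, $\gamma=\gamma_b+\gamma_\nabla$. Bulk pressure $p_b=n\mu_b-f_b$ and pressure $p=n\mu-f_b-\frac12c\,|\nabla n|^2=p_b-n\nabla\cdot(c\nabla n)-\frac12c|\nabla n|^2$. *)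

(* Defs.v *)
From HB Require Import structures.
From mathcomp Require Import all_boot all_order all_algebra.
From mathcomp Require Import all_classical all_reals all_analysis.
Import Order.TTheory GRing.Theory Num.Theory.
Import numFieldNormedType.Exports.

Set Implicit Arguments.
Unset Strict Implicit.
Unset Printing Implicit Defensive.

Local Open Scope classical_set_scope.
Local Open Scope ring_scope.

(* A decimal literal: the digits before and after the decimal point. *)
Variant literal := Literal of Decimal.uint & Decimal.uint.

Definition parse_literal (x : Number.number) : option literal :=
  if x is Number.Decimal (Decimal.Decimal (Decimal.Pos i) f)
  then Some (Literal i f) else None.

Definition print_literal (l : literal) : Number.number :=
  let: Literal i f := l in
  Number.Decimal (Decimal.Decimal (Decimal.Pos i) f).

Declare Scope literal_scope.
Delimit Scope literal_scope with literal.
Number Notation literal parse_literal print_literal : literal_scope.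

Section Numerals.
Context {R : realType}.

Fixpoint append_digits (r : R) (u : Decimal.uint) : R :=
  match u with
  | Decimal.Nil => r
  | Decimal.D0 v => append_digits (10 * r) v
  | Decimal.D1 v => append_digits (10 * r + 1) v
  | Decimal.D2 v => append_digits (10 * r + 2) v
  | Decimal.D3 v => append_digits (10 * r + 3) v
  | Decimal.D4 v => append_digits (10 * r + 4) v
  | Decimal.D5 v => append_digits (10 * r + 5) v
  | Decimal.D6 v => append_digits (10 * r + 6) v
  | Decimal.D7 v => append_digits (10 * r + 7) v
  | Decimal.D8 v => append_digits (10 * r + 8) v
  | Decimal.D9 v => append_digits (10 * r + 9) v
  end.

(* decimal 0.45724 is the number 0.45724 of R.  A rational constant with
   unary numerator and denominator would not be usable here. *)
Definition decimal (l : literal) : R :=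
  let: Literal i f := l in
  append_digits (append_digits 0 i) f / 10 ^+ Decimal.nb_digits f.

End Numerals.
Arguments decimal {R} l%_literal.

Section VectorCalculus.
Context {R : realType} {d : nat}.
Implicit Types (f : 'rV[R]_d -> R) (F : 'rV[R]_d -> 'rV[R]_d)
  (S : 'rV[R]_d -> 'M[R]_d) (x : 'rV[R]_d).

Definition partial (i : 'I_d) f : 'rV[R]_d -> R :=
  fun x => 'D_(delta_mx ord0 i) f x.

Definition grad f : 'rV[R]_d -> 'rV[R]_d := fun x => \row_i partial i f x.

Definition div F : 'rV[R]_d -> R :=
  fun x => \sum_i partial i (fun y => F y ord0 i) x.

(* (div S)_i = sum_j d_j S_ij *)
Definition tensor_div S : 'rV[R]_d -> 'rV[R]_d :=
  fun x => \row_i \sum_j partial j (fun y => S y i j) x.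

Definition tensor_prod (u v : 'rV[R]_d) : 'M[R]_d := u^T *m v.

(* The library norm `|u| on row vectors is the sup norm, hence this one. *)
Definition euclidean_sqnorm (u : 'rV[R]_d) : R := \sum_i u ord0 i ^+ 2.

(* f is of class C^k on the (open) set D *)
Fixpoint of_class (k : nat) (D : set 'rV[R]_d) f : Prop :=
  (forall x, D x -> {for x, continuous f}) /\
  if k is k'.+1 then
    forall i : 'I_d, (forall x, D x -> derivable f x (delta_mx ord0 i)) /\
                     of_class k' D (partial i f)
  else True.

End VectorCalculus.

Section OrientedIntegral.
Context {R : realType}.

(* The temperature may lie on either side of the reference temperature. *)
Definition oriented_integral (f : R -> R) (s t : R) : R :=
  if s <= t then \int[@lebesgue_measure R]_(u in `[s, t]) f u
  else - \int[@lebesgue_measure R]_(u in `[t, s]) f u.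

End OrientedIntegral.

Record fluid (R : realType) := Fluid {
  gas_constant : R;
  critical_temperature : R;
  critical_pressure : R;
  acentric_factor : R;
  heat_capacity_coef : 'I_4 -> R }.

(* All dimensional constants are in SI units. *)
Section PengRobinson.
Context {R : realType} (fl : fluid R).

Local Notation Rg := (gas_constant fl).
Local Notation Tc := (critical_temperature fl).
Local Notation Pc := (critical_pressure fl).
Local Notation omega := (acentric_factor fl).
Local Notation alpha := (heat_capacity_coef fl).

Implicit Types nu t : R.

Definition T0 : R := decimal 298.15.
Definition P0 : R := 10 ^+ 5. (* 1 bar in Pa *)
Definition theta0 : R := - decimal 2478.95687512.

Definition reduced_temperature t : R := t / Tc.

Definition psi_p t : R := \sum_(i < 4) alpha i * t ^+ i.

Definition pr_m : R :=
  if omega <= decimal 0.49 then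
    decimal 0.37464 + decimal 1.54226 * omega - decimal 0.26992 * omega ^+ 2
  else
    decimal 0.379642 + decimal 1.485030 * omega - decimal 0.164423 * omega ^+ 2
      + decimal 0.016666 * omega ^+ 3.

Definition pr_a t : R :=
  decimal 0.45724 * (Rg ^+ 2 * Tc ^+ 2 / Pc)
    * (1 + pr_m * (1 - Num.sqrt (reduced_temperature t))) ^+ 2.

Definition pr_b : R := decimal 0.07780 * (Rg * Tc / Pc).

Definition f_ideal nu t : R :=
  nu * theta0
  + nu * \sum_(i < 4) alpha i * ((t ^+ i.+1 - T0 ^+ i.+1) / i.+1%:R)
  - nu * Rg * (t - T0)
  - nu * Rg * t * ln (P0 / (nu * Rg * t))
  - nu * t * oriented_integral (fun tau => psi_p tau / tau) T0 t.

Definition f_repulsion nu t : R := - (nu * Rg * t * ln (1 - pr_b * nu)).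

Definition f_attraction nu t : R :=
  pr_a t * nu / (2 * Num.sqrt 2 * pr_b)
    * ln ((1 + (1 - Num.sqrt 2) * pr_b * nu)
          / (1 + (1 + Num.sqrt 2) * pr_b * nu)).

Definition f_b nu t : R := f_ideal nu t + f_repulsion nu t + f_attraction nu t.

Definition beta1 : R :=
  - (10 ^- 16 / (decimal 1.2326 + decimal 1.3757 * omega)).

Definition beta2 : R :=
  10 ^- 16 / (decimal 0.9051 + decimal 1.5410 * omega).

Definition influence t : R :=
  pr_a t * pr_b `^ (2 / 3) * (beta1 * (1 - reduced_temperature t) + beta2).

Definition mu_b nu t : R := derive1 (f_b ^~ t) nu.

Definition gamma_b nu t : R := derive1 (f_b nu) t.

Section Fields.
Context {d : nat}.
Variables n T : 'rV[R]_d -> R.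

Definition div_influence_grad : 'rV[R]_d -> R :=
  div (fun y => influence (T y) *: grad n y).

Definition mu (x : 'rV[R]_d) : R := mu_b (n x) (T x) - div_influence_grad x.

Definition gamma_grad (x : 'rV[R]_d) : R :=
  2^-1 * derive1 influence (T x) * euclidean_sqnorm (grad n x).

Definition gamma (x : 'rV[R]_d) : R := gamma_b (n x) (T x) + gamma_grad x.

Definition pressure (x : 'rV[R]_d) : R :=
  n x * mu x - f_b (n x) (T x)
    - 2^-1 * influence (T x) * euclidean_sqnorm (grad n x).

End Fields.
End PengRobinson.

(* Main.v *)
Require Import Defs.
From HB Require Import structures.
From mathcomp Require Import all_boot all_order all_algebra.
From mathcomp Require Import all_classical all_reals all_analysis.
From mathcomp Require Import ring lra.
Import Order.TTheory GRing.Theory Num.Theory.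
Import numFieldNormedType.Exports.
Local Open Scope classical_set_scope.
Local Open Scope ring_scope.
Set Implicit Arguments.
Unset Strict Implicit.
Unset Printing Implicit Defensive.

(** Write [F(nu, t)] for the bulk free energy density and [c(t)] for the
    influence parameter.  The chain rule gives
    [grad F(n, T) = mu_b grad n + gamma_b grad T], so when the gradient of
    [p = n mu - F - c |grad n|^2 / 2] is expanded, [n grad mu] and
    [gamma_b grad T] appear as they do on the left-hand side, and
    [mu - mu_b = - div (c grad n)] remains as the factor of [grad n].  What is
    left to prove is the purely kinematic identity
    [div (c grad n (x) grad n)
     = div (c grad n) grad n + c grad |grad n|^2 / 2]
    ([tensor_div_capillary]), since the derivative of [c] in
    [grad (c |grad n|^2 / 2)] is the part [gamma_grad grad T] of
    [gamma grad T].  The identity is the product rule together with the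
    symmetry of the Hessian of [n] ([mixed_derivatives_commute]), which follows
    from applying the mean value theorem twice to the second difference of [n]
    over a small parallelogram.

    The rest of the work is to justify the differentiations, since [mu] itself
    has to be differentiable.  On the admissible states the free energy is a
    sum of products of a function of the density and a function of the
    temperature ([f_bE]):
    [F(nu, t) = nu S(t) + h(nu) t + k(nu) a(t)].
    Hence the chain rule for [F] and the differentiability of [mu_b] need only
    one-variable facts: [S] is differentiable, and [h], [k] have a first
    derivative that is itself differentiable, as does [c].  The latter property
    is closed under the arithmetic operations and composition
    ([twice_derivable]).  The only part of [S] that is not elementary is the
    integral of [psi_p(tau) / tau], for which an explicit primitive is
    given. *)

(** * Mean value theorems along lines and the symmetry of second derivatives *)

(** A directional derivative is the derivative of a one-variable function, at
    every parameter of the line; this transports one-variable theorems (chain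
    rule, mean value theorem) to directional derivatives. *)
Lemma is_derive_lineP (R : realType) (V : normedModType R) (f : V -> R)
    (y u : V) (t df : R) :
  is_derive t (1 : R) (fun h : R => f (h *: u + y)) df <->
  is_derive (t *: u + y) u f df.
Proof.
have e : (fun h : R => h^-1 *: (((fun h : R => f (h *: u + y)) \o
      shift t) (h *: (1 : R)) - f (t *: u + y)))
    = (fun h : R => h^-1 *: ((f \o shift (t *: u + y)) (h *: u)
         - f (t *: u + y))).
  by apply/funext => h /=; rewrite [_%:A]mulr1 scalerDl addrA.
by split=> -[]; rewrite /derivable /derive => d dE; split;
  rewrite /derivable /derive ?e // -?e.
Qed.

Lemma is_derive_comp_scalar (R : realType) (V : normedModType R)
    (f : R -> R) (g : V -> R) (x v : V) (a b : R) :
  is_derive (g x) 1 f a -> is_derive x v g b ->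
  is_derive x v (fun y => f (g y)) (a * b).
Proof.
have -> : x = 0 *: v + x by rewrite scale0r add0r.
move=> df /is_derive_lineP dg; apply/is_derive_lineP.
exact: is_derive1_comp df dg.
Qed.

Lemma MVT_line (R : realType) (V : normedModType R) (f : V -> R)
    (y u : V) (s : R) : 0 < s ->
  (forall t, 0 <= t <= s -> derivable f (t *: u + y) u) ->
  exists2 a, 0 <= a <= s &
    f (s *: u + y) - f y = s * 'D_u f (a *: u + y).
Proof.
move=> s0 df.
have [t||a] := @MVT R (fun h => f (h *: u + y))
  (fun t => 'D_u f (t *: u + y)) 0 s s0.
- rewrite in_itv /= => /andP[t0 ts].
  by apply/is_derive_lineP/derivableP; apply: df; rewrite !ltW.
- apply: derivable_within_continuous => t; rewrite in_itv /= => ts.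
  apply: ex_derive; apply/is_derive_lineP/derivableP; exact: df.
- rewrite in_itv /= scale0r add0r subr0 => /andP[a0 ai] ->.
  by exists a; [rewrite !ltW|rewrite mulrC].
Qed.

(** Differencing first in [v] and applying the mean value theorem in [u], then
    the mean value theorem in [v], brings out ['D_v ('D_u f)].  The second
    difference is symmetric in [u] and [v], so exchanging the roles of the
    directions produces the other mixed derivative. *)
Lemma second_difference_MVT (R : realType) (V : normedModType R) (f : V -> R)
    (x u v : V) (s : R) : 0 < s ->
  (forall a b, 0 <= a <= s -> 0 <= b <= s ->
     derivable f (a *: u + (b *: v + x)) u /\
     derivable ('D_u f) (b *: v + (a *: u + x)) v) ->
  exists a b, [/\ 0 <= a <= s, 0 <= b <= s &
    f (s *: u + (s *: v + x)) - f (s *: u + x) - f (s *: v + x) + f x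
    = s ^+ 2 * 'D_v ('D_u f) (b *: v + (a *: u + x))].
Proof.
move=> s0 df.
have ss : 0 <= s <= s by rewrite ltW /=.
have zs : 0 <= (0 : R) <= s by rewrite lexx ltW.
pose phi y := f (y + s *: v) - f y.
have dphi t : 0 <= t <= s ->
    is_derive (t *: u + x) u phi
      ('D_u f (s *: v + (t *: u + x)) - 'D_u f (t *: u + x)).
  move=> ts; apply: is_deriveB; last first.
    have [] := df t 0 ts zs; rewrite scale0r !add0r => d _; exact: derivableP.
  have [] := df t s ts ss; rewrite addrCA => /derivableP [d dE] _.
  have e : (fun h : R => h^-1 *: (((fun y => f (y + s *: v)) \o
      shift (t *: u + x)) (h *: u) - f (t *: u + x + s *: v)))
    = (fun h : R => h^-1 *: ((f \o shift (s *: v + (t *: u + x))) (h *: u)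
         - f (s *: v + (t *: u + x)))).
    by apply/funext => h /=; rewrite -addrA [in RHS](addrC (s *: v)).
  by split; [rewrite /derivable e|rewrite /derive e].
have [t ts|a ap] := @MVT_line _ _ phi x u s s0.
  by case: (dphi t ts).
have [_ ->] := dphi a ap.
have [t ts|b bp] := @MVT_line _ _ ('D_u f) (a *: u + x) v s s0.
  by have [] := df a t ap ts.
move=> -> E; exists a, b; split=> //.
rewrite expr2 -mulrA -E /phi -(addrA (s *: u) x) (addrC x); ring.
Qed.

Lemma nbhs_parallelogram (R : realType) (V : normedModType R) (x u v : V)
    (A : set V) : nbhs x A ->
  exists2 s : R, 0 < s & forall a b, 0 <= a <= s -> 0 <= b <= s ->
    A (a *: u + (b *: v + x)).
Proof.
move=> /nbhs_ballP[e /= e0 eA].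
pose M := `|u| + `|v| + 1.
have M0 : 0 < M by rewrite ltr_wpDl // addr_ge0.
exists (e / M); first exact: divr_gt0.
move=> a b /andP[a0 ae] /andP[b0 be]; apply: eA.
rewrite -ball_normE /ball_ /= addrA opprD addrCA subrr addr0 normrN.
have h : `|a *: u + b *: v| <= e / M * (`|u| + `|v|).
  rewrite (le_trans (ler_normD _ _)) // !normrZ !ger0_norm // mulrDr.
  by rewrite lerD // ler_wpM2r.
apply: le_lt_trans h _.
by rewrite -mulrA gtr_pMr // mulrC ltr_pdivrMr // mul1r /M ltrDl.
Qed.

(** Both mixed derivatives, each at some point of an arbitrarily small
    parallelogram at [x], equal the same second difference divided by [s ^ 2];
    by continuity at [x] they agree there. *)
Lemma mixed_derivatives_commute (R : realType) (V : normedModType R)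
    (f : V -> R) (x u v : V) :
  (\forall y \near x, derivable f y u /\ derivable f y v /\
     derivable ('D_u f) y v /\ derivable ('D_v f) y u) ->
  {for x, continuous ('D_v ('D_u f))} ->
  {for x, continuous ('D_u ('D_v f))} ->
  'D_v ('D_u f) x = 'D_u ('D_v f) x.
Proof.
move=> df cvu cuv; apply/eqP; rewrite -subr_eq0 -normr_le0.
apply/ler_addgt0Pl => e e0; rewrite addr0.
have e2 : 0 < e / 2 by rewrite divr_gt0.
have /cvgrPdist_lt/(_ _ e2) nvu := cvu.
have /cvgrPdist_lt/(_ _ e2) nuv := cuv.
(* The side [s] is so small that both mixed derivatives vary by less than
   [e / 2] on the parallelogram. *)
have [s s0 sA] := nbhs_parallelogram u v (filterI df (filterI nvu nuv)).
have [a b ap bp|a [b [ap bp E1]]] := @second_difference_MVT _ _ f x u v s s0.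
  have [[du _] _] := sA a b ap bp.
  split; first exact: du.
  have dv := sA a b ap bp; rewrite addrCA in dv.
  by case: dv => -[_ [_ [dv _]]] _; exact: dv.
have [a' b' ap' bp'|b' [a' [bp' ap' E2]]] :=
    @second_difference_MVT _ _ f x v u s s0.
  have [[_ [_ [_ du]]] _] := sA b' a' bp' ap'.
  split; last exact: du.
  have dv := sA b' a' bp' ap'; rewrite addrCA in dv.
  by case: dv => -[_ [dv _]] _; exact: dv.
have : s ^+ 2 * 'D_v ('D_u f) (b *: v + (a *: u + x))
     = s ^+ 2 * 'D_u ('D_v f) (a' *: u + (b' *: v + x)).
  by rewrite -E1 -E2 (addrCA (s *: u)); ring.
move/(mulfI (lt0r_neq0 (exprn_gt0 2 s0))) => E.
have [_ [h1 _]] := sA a b ap bp; rewrite addrCA E in h1.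
have [_ [_ h2]] := sA a' b' ap' bp'.
rewrite [e]splitr.
apply: le_trans (ler_distD ('D_u ('D_v f) (a' *: u + (b' *: v + x))) _ _) _.
by apply: lerD; [exact: ltW h1|rewrite distrC; exact: ltW h2].
Qed.

(** * Functions with a differentiable derivative *)

(** Differentiability near the point, rather than only at it, is what makes the
    derivative of a sum, product or composite computable near the point, and so
    makes the notion stable. *)
Definition twice_derivable (R : realType) (f : R -> R) (x : R) : Prop :=
  (\forall y \near x, derivable f y 1) /\ derivable (derive1 f) x 1.

Section TwiceDerivable.
Context {R : realType}.
Implicit Types (f g : R -> R) (x a : R).

Lemma twice_derivableW f x : twice_derivable f x -> derivable f x 1.
Proof. by case=> /nbhs_singleton. Qed.

Lemma twice_derivable_cst a x : twice_derivable (fun=> a) x.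
Proof.
split; first by near=> y; exact: derivable_cst.
rewrite (_ : derive1 _ = cst 0); first exact: derivable_cst.
by apply/funext => y; rewrite derive1_cst.
Unshelve. all: by end_near. Qed.

Lemma twice_derivable_id x : twice_derivable (fun y => y) x.
Proof.
split; first by near=> y; exact: derivable_id.
rewrite (_ : derive1 _ = cst (1 : R)); first exact: derivable_cst.
by apply/funext => y; rewrite derive1E derive_id.
Unshelve. all: by end_near. Qed.

Lemma twice_derivableD f g x : twice_derivable f x -> twice_derivable g x ->
  twice_derivable (fun y => f y + g y) x.
Proof.
move=> [nf df] [ng dg]; split.
  by apply: filterS2 nf ng => y fy gy; exact: (derivableD fy gy).
apply: near_eq_derivable (derivableD df dg).
apply: filterS2 nf ng => y fy gy.
rewrite -[LHS]/(derive1 f y + derive1 g y) !derive1E.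
exact: (esym (deriveD fy gy)).
Qed.

Lemma twice_derivableM f g x : twice_derivable f x -> twice_derivable g x ->
  twice_derivable (fun y => f y * g y) x.
Proof.
move=> f2 g2; have [[nf df] [ng dg]] := (f2, g2).
have [f1 g1] := (twice_derivableW f2, twice_derivableW g2).
split.
  by apply: filterS2 nf ng => y fy gy; exact: (derivableM fy gy).
apply: near_eq_derivable (derivableD (derivableM f1 dg) (derivableM g1 df)).
apply: filterS2 nf ng => y fy gy.
rewrite -[LHS]/(f y *: derive1 g y + g y *: derive1 f y) !derive1E.
exact: (esym (deriveM fy gy)).
Qed.

Lemma twice_derivableN f x :
  twice_derivable f x -> twice_derivable (fun y => - f y) x.
Proof.
rewrite (_ : (fun y => - f y) = (fun y => (-1) * f y)).
  exact: (twice_derivableM (twice_derivable_cst (-1) x)).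
by apply/funext => y; rewrite mulN1r.
Qed.

Lemma derivable1_comp f g x :
  derivable f (g x) 1 -> derivable g x 1 -> derivable (fun y => f (g y)) x 1.
Proof.
move=> /derivableP df /derivableP dg.
by case: (is_derive1_comp df dg).
Qed.

Lemma twice_derivable_comp f g x :
  twice_derivable f (g x) -> twice_derivable g x ->
  twice_derivable (fun y => f (g y)) x.
Proof.
move=> [nf df] g2; have [ng dg] := g2; have g1 := twice_derivableW g2.
have cg : {for x, continuous g}.
  by apply: differentiable_continuous; rewrite -derivable1_diffP.
have nfg : nbhs x (fun y => derivable f (g y) 1) by move: (cg _ nf).
split.
  by apply: filterS2 nfg ng => y fgy gy; exact: (derivable1_comp fgy gy).
apply: near_eq_derivable (derivableM (derivable1_comp df g1) dg).
apply: filterS2 nfg ng => y fgy gy.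
exact: (esym (derive1_comp gy fgy)).
Qed.

Lemma derivableV1 x : x != 0 -> derivable (@GRing.inv R) x 1.
Proof.
by move=> x0; apply: (derivableV (f := id)) => //; exact: derivable_id.
Qed.

Lemma twice_derivable_ln x : 0 < x -> twice_derivable (@ln R) x.
Proof.
move=> x0; split.
  near=> y; have y0 : 0 < y by near: y; exact: lt_nbhsr.
  by case: (is_derive1_ln y0).
apply: near_eq_derivable (derivableV1 (lt0r_neq0 x0)).
near=> y; have y0 : 0 < y by near: y; exact: lt_nbhsr.
by rewrite derive1E; case: (is_derive1_ln y0).
Unshelve. all: by end_near. Qed.

Lemma twice_derivable_sqrt x : 0 < x -> twice_derivable (@Num.sqrt R) x.
Proof.
move=> x0; have [d1 _] := is_derive1_sqrt x0.
have s0 : 2 * Num.sqrt x != 0 by rewrite mulf_neq0 // gt_eqF // sqrtr_gt0.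
split.
  near=> y; have y0 : 0 < y by near: y; exact: lt_nbhsr.
  by case: (is_derive1_sqrt y0).
apply: near_eq_derivable
  (derivableV (f := fun y : R => 2 * Num.sqrt y) s0
    (derivableM (derivable_cst _ _ _) d1)).
near=> y; have y0 : 0 < y by near: y; exact: lt_nbhsr.
by rewrite derive1E; case: (is_derive1_sqrt y0).
Unshelve. all: by end_near. Qed.

End TwiceDerivable.

(** * The Peng-Robinson free energy on admissible states *)

(** The sign convention of the oriented integral makes one formula valid on
    both sides of the lower bound. *)
Lemma oriented_integral_primitive (R : realType) (f F : R -> R) (s t : R) :
  (forall u : R, 0 < u -> {for u, continuous f}) ->
  (forall u : R, 0 < u -> is_derive u 1 F (f u)) ->
  0 < s -> 0 < t -> oriented_integral f s t = F t - F s.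
Proof.
move=> cf dF.
have FTC a b : 0 < a -> a < b ->
    \int[@lebesgue_measure R]_(u in `[a, b]) f u = F b - F a.
  move=> a0 ab.
  have cF u : 0 < u -> {for u, continuous F}.
    move=> /dF[d _]; apply: differentiable_continuous.
    by rewrite -derivable1_diffP.
  rewrite /Rintegral (@continuous_FTC2 _ f F) //.
  - apply: continuous_in_subspaceT => u.
    rewrite inE /= in_itv /= => /andP[au _].
    exact: cf (lt_le_trans a0 au).
  - split.
    + move=> u; rewrite in_itv /= => /andP[au _].
      by case: (dF u (lt_trans a0 au)).
    + exact: cvg_at_right_filter (cF a a0).
    + exact: cvg_at_left_filter (cF b (lt_trans a0 ab)).
  - move=> u; rewrite in_itv /= => /andP[au _].
    by rewrite derive1E; case: (dF u (lt_trans a0 au)).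
move=> s0 t0; rewrite /oriented_integral.
have [st|ts|->] := ltgtP s t.
- exact: FTC.
- by rewrite FTC // opprB.
- by rewrite set_itv1 Rintegral_set1 subrr.
Qed.

Section PengRobinson.
Context {R : realType} (fl : fluid R).
Hypotheses (Rg_gt0 : 0 < gas_constant fl) (Tc_gt0 : 0 < critical_temperature fl)
  (Pc_gt0 : 0 < critical_pressure fl).
Local Notation Rg := (gas_constant fl).
Local Notation Tc := (critical_temperature fl).
Local Notation alpha := (heat_capacity_coef fl).
Local Notation b := (pr_b fl).
Implicit Types nu t : R.

Lemma pr_b_gt0 : 0 < b.
Proof.
rewrite /pr_b mulr_gt0 ?divr_gt0 ?mulr_gt0 //.
by rewrite /=; lra.
Qed.

Lemma T0_gt0 : 0 < T0 :> R.
Proof. by rewrite /T0 /decimal /= divr_gt0 ?exprn_gt0 //; lra. Qed.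

(** The primitive of [psi_p(tau) / tau]: the constant term of [psi_p] gives the
    logarithm and the term of degree [i + 1] is divided by [i + 1]. *)
Definition entropy_primitive t : R :=
  alpha ord0 * ln t
  + \sum_(i < 3) alpha (lift ord0 i) * (t ^+ i.+1 / i.+1%:R).

Lemma is_derive_entropy_primitive t : 0 < t ->
  is_derive t 1 entropy_primitive (psi_p fl t / t).
Proof.
move=> t0.
have -> : psi_p fl t / t
    = alpha ord0 *: t^-1 + \sum_(i < 3) alpha (lift ord0 i) * t ^+ i.
  rewrite /psi_p big_ord_recl /= expr0 mulr1 mulrDl mulr_suml.
  congr (_ + _); apply: eq_bigr => i _.
  by rewrite -[bump 0 i]/i.+1 exprSr -!mulrA divff ?mulr1 // gt_eqF.
rewrite (_ : entropy_primitive = (alpha ord0 \*: @ln R) +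
  \sum_(i < 3) ((alpha (lift ord0 i) / i.+1%:R) \*: (id ^+ i.+1))); last first.
  apply/funext => u; rewrite /entropy_primitive /= fctE fct_sumE.
  congr (_ + _); apply: eq_bigr => i _.
  by rewrite exprfctE /= [RHS]mulrAC mulrA.
apply: is_deriveD; first by apply: is_deriveZ; exact: is_derive1_ln.
apply: is_derive_sum => i.
have dX : is_derive t (1 : R) (id ^+ i.+1 : R -> R) _ :=
  is_deriveX i.+1 (is_derive_id t (1 : R)).
apply: is_derive_eq (is_deriveZ (alpha (lift ord0 i) / i.+1%:R) dX) _.
rewrite /GRing.scale /= mulr1; field.
by rewrite nat1r pnatr_eq0.
Qed.

(** The next three functions are the coefficients of the separated form [f_bE]
    of the free energy density: [thermal_part] multiplies the density,
    [hard_core_part] the temperature and [attraction_part] the coefficient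
    [pr_a].  The logarithm [ln (P0 / (nu Rg t))] of the ideal part is split
    between the first two. *)
Definition thermal_part t : R :=
  theta0 + \sum_(i < 4) alpha i * ((t ^+ i.+1 - T0 ^+ i.+1) / i.+1%:R)
  - Rg * (t - T0) - Rg * t * (ln P0 - ln (Rg * t))
  - t * oriented_integral (fun tau => psi_p fl tau / tau) T0 t.

Definition hard_core_part nu : R := Rg * (nu * (ln nu - ln (1 - b * nu))).

Definition attraction_part nu : R :=
  nu / (2 * Num.sqrt 2 * b)
    * (ln (1 + (1 - Num.sqrt 2) * b * nu)
       - ln (1 + (1 + Num.sqrt 2) * b * nu)).

Definition admissible_density nu : Prop := 0 < nu < 1 / b.

Lemma hard_core_gt0 nu : admissible_density nu -> 0 < 1 - b * nu.
Proof.
by move=> /andP[_]; rewrite ltr_pdivlMr ?pr_b_gt0 // mulrC -subr_gt0.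
Qed.

(** With [q = b nu < 1] and [r = sqrt 2 < 2], the first factor is
    [1 + (1 - r) q = (1 - q) + (2 - r) q]. *)
Lemma attraction_factors_gt0 nu : admissible_density nu ->
  0 < 1 + (1 - Num.sqrt 2) * b * nu /\ 0 < 1 + (1 + Num.sqrt 2) * b * nu.
Proof.
move=> nuP; have q1 := hard_core_gt0 nuP.
have q0 : 0 < b * nu by case/andP: nuP => ? _; rewrite mulr_gt0 ?pr_b_gt0.
have r0 : 0 <= Num.sqrt 2 :> R := sqrtr_ge0 _.
have r2 : Num.sqrt 2 ^+ 2 = 2 :> R by rewrite sqr_sqrtr.
move: (Num.sqrt 2) r0 r2 => r r0 r2.
have r_lt2 : r < 2 by rewrite ltNge; apply/negP => h; nra.
rewrite -!(mulrA _ b nu); move: (b * nu) q0 q1 => q q0 q1.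
split.
  rewrite (_ : 1 + (1 - r) * q = (1 - q) + (2 - r) * q); last by ring.
  by rewrite addr_gt0 // mulr_gt0 // subr_gt0.
apply: ltr_wpDr => //.
by apply: mulr_ge0; [exact: addr_ge0 ler01 r0|exact: ltW].
Qed.

Lemma near_admissible_density nu : admissible_density nu ->
  \forall y \near nu, admissible_density y.
Proof.
move=> /andP[nu0 nu1].
by near=> y; apply/andP; split; near: y; [exact: lt_nbhsr|exact: lt_nbhsl].
Unshelve. all: by end_near. Qed.

(** All arguments of logarithms are positive, so that the logarithms of
    quotients and products split into functions of one variable. *)
Lemma f_bE nu t : admissible_density nu -> 0 < t ->
  f_b fl nu t = nu * thermal_part t + hard_core_part nu * t
                + attraction_part nu * pr_a fl t.
Proof.
move=> nuP t0; have /andP[nu0 _] := nuP.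
have [h1 h2] := attraction_factors_gt0 nuP.
have Rt0 : 0 < Rg * t by rewrite mulr_gt0.
rewrite /f_b /f_ideal /f_repulsion /f_attraction /thermal_part.
rewrite /hard_core_part /attraction_part.
rewrite -(mulrA nu Rg t) ln_div ?posrE ?mulr_gt0 ?exprn_gt0 //.
rewrite lnM ?posrE // ln_div ?posrE //.
set S := \sum_(i < 4) _; set J := oriented_integral _ _ _.
move: (b) (pr_a fl t) => k a; ring.
Qed.

Lemma oriented_integral_psiE t : 0 < t ->
  oriented_integral (fun tau => psi_p fl tau / tau) T0 t
  = entropy_primitive t - entropy_primitive T0.
Proof.
move=> t0; apply: oriented_integral_primitive => //; last exact: T0_gt0.
  move=> u u0; apply: continuousM; last exact: (inv_continuous (lt0r_neq0 u0)).
  apply: continuous_big => [|i _ v]; first exact: add_continuous.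
  by apply: cvgM; [exact: cvg_cst|exact: exprn_continuous].
exact: is_derive_entropy_primitive.
Qed.

Lemma derivable_thermal_part t : 0 < t -> derivable thermal_part t 1.
Proof.
move=> t0.
have dJ : derivable
    (fun t => oriented_integral (fun tau => psi_p fl tau / tau) T0 t) t 1.
  have [d _] := is_derive_entropy_primitive t0.
  apply: near_eq_derivable
    (derivableB d (derivable_cst (entropy_primitive T0) _ _)).
  near=> u; have u0 : 0 < u by near: u; exact: lt_nbhsr.
  by rewrite oriented_integral_psiE.
have dS : derivable (fun t : R => \sum_(i < 4)
    alpha i * ((t ^+ i.+1 - T0 ^+ i.+1) / i.+1%:R)) t 1.
  rewrite (_ : (fun _ => _) = \sum_(i < 4) (fun t : R =>
    alpha i * ((t ^+ i.+1 - T0 ^+ i.+1) / i.+1%:R))).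
    apply: derivable_sum => i.
    have d1 := derivableB (@exprn_derivable R i.+1 t 1)
      (derivable_cst (T0 ^+ i.+1 : R) t (1 : R)).
    exact: (derivableM (derivable_cst (alpha i) _ _)
      (derivableM d1 (derivable_cst (i.+1%:R^-1 : R) _ _))).
  by apply/funext => u; rewrite fct_sumE.
have dl : derivable (fun t => ln (Rg * t)) t 1.
  apply: (twice_derivableW (twice_derivable_comp (f := @ln R) _ _)).
    exact: twice_derivable_ln (mulr_gt0 Rg_gt0 t0).
  exact: twice_derivableM (twice_derivable_cst Rg t) (twice_derivable_id t).
have dc a := twice_derivableW (twice_derivable_cst a t).
have di := twice_derivableW (twice_derivable_id t).
(* The summands of [thermal_part], in the order of its definition. *)
have := derivableB (derivableB (derivableB (derivableD (dc theta0) dS)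
  (derivableM (dc Rg) (derivableB di (dc T0))))
  (derivableM (derivableM (dc Rg) di) (derivableB (dc (ln P0)) dl)))
  (derivableM di dJ).
exact.
Unshelve. all: by end_near. Qed.

Lemma twice_derivable_affine (p q x : R) :
  twice_derivable (fun y => p + q * y) x.
Proof.
apply: twice_derivableD; first exact: twice_derivable_cst.
apply: twice_derivableM; first exact: twice_derivable_cst.
exact: twice_derivable_id.
Qed.

Lemma twice_derivable_ln_affine (p q x : R) : 0 < p + q * x ->
  twice_derivable (fun y => ln (p + q * y)) x.
Proof.
move=> h; apply: (twice_derivable_comp (f := @ln R) (g := fun y => p + q * y)).
  exact: twice_derivable_ln.
exact: twice_derivable_affine.
Qed.

Lemma twice_derivable_hard_core nu : admissible_density nu ->
  twice_derivable hard_core_part nu.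
Proof.
move=> nuP; have := hard_core_gt0 nuP; have /andP[nu0 _] := nuP => h.
apply: twice_derivableM; first exact: twice_derivable_cst.
apply: twice_derivableM; first exact: twice_derivable_id.
apply: twice_derivableD; first exact: twice_derivable_ln.
apply: twice_derivableN.
rewrite (_ : (fun _ => _) = (fun y => ln (1 + (- b) * y))).
  by apply: twice_derivable_ln_affine; rewrite mulNr.
by apply/funext => y; rewrite mulNr.
Qed.

Lemma twice_derivable_attraction nu : admissible_density nu ->
  twice_derivable attraction_part nu.
Proof.
move=> nuP; have [h1 h2] := attraction_factors_gt0 nuP.
apply: twice_derivableM.
  apply: twice_derivableM; first exact: twice_derivable_id.
  exact: twice_derivable_cst.
apply: twice_derivableD; first exact: twice_derivable_ln_affine.
by apply: twice_derivableN; exact: twice_derivable_ln_affine.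
Qed.

Lemma twice_derivable_pr_a t : 0 < t -> twice_derivable (pr_a fl) t.
Proof.
move=> t0.
have d1 : twice_derivable
    (fun t => 1 + pr_m fl * (1 - Num.sqrt (reduced_temperature fl t))) t.
  apply: twice_derivableD; first exact: twice_derivable_cst.
  apply: twice_derivableM; first exact: twice_derivable_cst.
  apply: twice_derivableD; first exact: twice_derivable_cst.
  apply: twice_derivableN.
  apply: (twice_derivable_comp (f := @Num.sqrt R)).
    by apply: twice_derivable_sqrt; rewrite divr_gt0.
  apply: twice_derivableM; first exact: twice_derivable_id.
  exact: twice_derivable_cst.
rewrite (_ : pr_a fl = fun t =>
   decimal 0.45724 * (Rg ^+ 2 * Tc ^+ 2 / critical_pressure fl) *
   ((1 + pr_m fl * (1 - Num.sqrt (reduced_temperature fl t))) *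
   (1 + pr_m fl * (1 - Num.sqrt (reduced_temperature fl t)))));
  last by apply/funext => u; rewrite /pr_a expr2.
apply: twice_derivableM; first exact: twice_derivable_cst.
exact: (twice_derivableM d1 d1).
Qed.

Lemma twice_derivable_influence t : 0 < t ->
  twice_derivable (influence fl) t.
Proof.
move=> t0; apply: twice_derivableM.
  apply: twice_derivableM; first exact: twice_derivable_pr_a.
  exact: twice_derivable_cst.
apply: twice_derivableD; last exact: twice_derivable_cst.
apply: twice_derivableM; first exact: twice_derivable_cst.
apply: twice_derivableD; first exact: twice_derivable_cst.
apply: twice_derivableN.
apply: twice_derivableM; first exact: twice_derivable_id.
exact: twice_derivable_cst.
Qed.

(** * The chain rule for the free energy density *)

Section Chain.
Context {V : normedModType R}.
Variables (n T : V -> R) (x : V).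
Hypothesis nT_near : \forall y \near x, admissible_density (n y) /\ 0 < T y.

(** With coordinate functions or constants for [n] and [T] this also computes
    the partial derivatives [mu_b] and [gamma_b], in terms of which it is then
    restated as [is_derive_f_b]. *)
Lemma is_derive_f_b_split (v : V) (dn dT : R) :
  is_derive x v n dn -> is_derive x v T dT ->
  is_derive x v (fun y => f_b fl (n y) (T y))
    ((thermal_part (T x) + derive1 hard_core_part (n x) * T x
      + derive1 attraction_part (n x) * pr_a fl (T x)) * dn
     + (n x * derive1 thermal_part (T x) + hard_core_part (n x)
        + attraction_part (n x) * derive1 (pr_a fl) (T x)) * dT).
Proof.
move=> dnx dTx; have [nP Tx_gt0] := nbhs_singleton nT_near.
have dderive (f : R -> R) (z : R) :
    derivable f z 1 -> is_derive z (1 : R) f (derive1 f z).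
  by move=> d; rewrite derive1E; exact: derivableP.
have dS := is_derive_comp_scalar
  (dderive _ _ (derivable_thermal_part Tx_gt0)) dTx.
have dh := is_derive_comp_scalar
  (dderive _ _ (twice_derivableW (twice_derivable_hard_core nP))) dnx.
have dk := is_derive_comp_scalar
  (dderive _ _ (twice_derivableW (twice_derivable_attraction nP))) dnx.
have da := is_derive_comp_scalar
  (dderive _ _ (twice_derivableW (twice_derivable_pr_a Tx_gt0))) dTx.
have dF := is_deriveD (is_deriveD (is_deriveM dnx dS) (is_deriveM dh dTx))
  (is_deriveM dk da).
have e : \forall y \near x,
    (n * (fun y => thermal_part (T y)) + (fun y => hard_core_part (n y)) * T
    + (fun y => attraction_part (n y)) * (fun y => pr_a fl (T y))) y
    = f_b fl (n y) (T y).
  by apply: filterS nT_near => y [nyP Ty0]; rewrite f_bE.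
apply: is_derive_eq (near_eq_is_derive e dF) _.
rewrite /GRing.scale /=; ring.
Qed.

End Chain.

Lemma mu_bE nu t : admissible_density nu -> 0 < t ->
  mu_b fl nu t = thermal_part t + derive1 hard_core_part nu * t
                 + derive1 attraction_part nu * pr_a fl t.
Proof.
move=> nuP t0.
have near_nu : \forall y \near nu, admissible_density y /\ 0 < t.
  by apply: filterS (near_admissible_density nuP).
have [_ E] := is_derive_f_b_split near_nu (is_derive_id nu (1 : R))
  (is_derive_cst t nu (1 : R)).
by rewrite /mu_b derive1E; apply: etrans E _; rewrite mulr1 mulr0 addr0.
Qed.

Lemma gamma_bE nu t : admissible_density nu -> 0 < t ->
  gamma_b fl nu t = nu * derive1 thermal_part t + hard_core_part nu
                    + attraction_part nu * derive1 (pr_a fl) t.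
Proof.
move=> nuP t0.
have near_t : \forall y \near t, admissible_density nu /\ 0 < y.
  by apply: filterS (lt_nbhsr t0).
have [_ E] := is_derive_f_b_split near_t (is_derive_cst nu t (1 : R))
  (is_derive_id t (1 : R)).
by rewrite /gamma_b derive1E; apply: etrans E _; rewrite mulr1 mulr0 add0r.
Qed.

Section Fields.
Context {V : normedModType R}.
Variables (n T : V -> R) (x v : V).
Hypothesis nT_near : \forall y \near x, admissible_density (n y) /\ 0 < T y.

Lemma is_derive_f_b (dn dT : R) :
  is_derive x v n dn -> is_derive x v T dT ->
  is_derive x v (fun y => f_b fl (n y) (T y))
    (mu_b fl (n x) (T x) * dn + gamma_b fl (n x) (T x) * dT).
Proof.
have [nP Tx_gt0] := nbhs_singleton nT_near.
move=> dn_x dT_x; rewrite (mu_bE nP Tx_gt0) (gamma_bE nP Tx_gt0).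
exact: (is_derive_f_b_split nT_near dn_x dT_x).
Qed.

(** The separated form of [mu_b] contains the first derivatives of
    [hard_core_part] and [attraction_part], so that these have to be
    differentiable once more. *)
Lemma derivable_mu_b : derivable n x v -> derivable T x v ->
  derivable (fun y => mu_b fl (n y) (T y)) x v.
Proof.
move=> dn dT; have [nP Tx_gt0] := nbhs_singleton nT_near.
have comp (f : R -> R) (g : V -> R) : derivable f (g x) 1 -> derivable g x v ->
    derivable (fun y => f (g y)) x v.
  move=> /derivableP df /derivableP dg.
  by case: (is_derive_comp_scalar df dg).
have [_ dh] := twice_derivable_hard_core nP.
have [_ dk] := twice_derivable_attraction nP.
have dF := derivableD (derivableD (comp _ _ (derivable_thermal_part Tx_gt0) dT)
    (derivableM (comp _ _ dh dn) dT))
  (derivableM (comp _ _ dk dn)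
     (comp _ _ (twice_derivableW (twice_derivable_pr_a Tx_gt0)) dT)).
apply: near_eq_derivable dF.
by apply: filterS nT_near => y [nyP Ty0]; rewrite (mu_bE nyP Ty0).
Qed.

End Fields.

End PengRobinson.

(** * The divergence of the capillary stress *)

Section OfClass.
Context {R : realType} {d : nat}.
Implicit Types (D : set 'rV[R]_d) (f : 'rV[R]_d -> R).

Lemma of_class_continuous k D f x :
  of_class k D f -> D x -> {for x, continuous f}.
Proof. by case: k => [|k] [cf _]; exact: cf. Qed.

Lemma of_class_derivable k D f i x :
  of_class k.+1 D f -> D x -> derivable f x (delta_mx ord0 i).
Proof. by case=> _ /(_ i)[df _]; exact: df. Qed.

Lemma of_class_partial k D f i :
  of_class k.+1 D f -> of_class k D (partial i f).
Proof. by case=> _ /(_ i)[]. Qed.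

Lemma of_classW k D f : of_class k.+1 D f -> of_class k D f.
Proof.
elim: k f => [|k IHk] f [cf df]; split=> // i.
by have [dfi fi] := df i; split; [exact: dfi|exact: IHk].
Qed.

Lemma partialC D f i j x : open D -> of_class 2 D f -> D x ->
  partial i (partial j f) x = partial j (partial i f) x.
Proof.
move=> oD f2 Dx.
have nD : \forall y \near x, D y by exact: open_nbhs_nbhs.
apply: mixed_derivatives_commute.
- apply: filterS nD => y Dy; split; first exact: of_class_derivable f2 Dy.
  split; first exact: of_class_derivable f2 Dy.
  split; exact: of_class_derivable (of_class_partial _ f2) Dy.
- exact: of_class_continuous (of_class_partial i (of_class_partial j f2)) Dx.
- exact: of_class_continuous (of_class_partial j (of_class_partial i f2)) Dx.
Qed.

End OfClass.

Section CapillaryStress.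
Context {R : realType} {d : nat}.
Variables (D : set 'rV[R]_d) (c : R -> R) (n T : 'rV[R]_d -> R).
Hypotheses (D_open : open D) (n_C3 : of_class 3 D n) (T_C2 : of_class 2 D T)
  (c_C2 : forall x, D x -> twice_derivable c (T x)).
Implicit Types (x y : 'rV[R]_d) (i j k : 'I_d).

Let dn k j y : D y ->
  is_derive y (delta_mx ord0 j) (partial k n) (partial j (partial k n) y).
Proof.
move=> Dy; apply: derivableP.
exact: of_class_derivable (of_class_partial k n_C3) Dy.
Qed.

Let dT j y : D y -> is_derive y (delta_mx ord0 j) T (partial j T y).
Proof.
by move=> Dy; apply: derivableP; exact: of_class_derivable T_C2 Dy.
Qed.

Lemma is_derive_coefficient x j : D x ->
  is_derive x (delta_mx ord0 j) (fun y => c (T y))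
    (derive1 c (T x) * partial j T x).
Proof.
move=> Dx; apply: is_derive_comp_scalar.
  by rewrite derive1E; apply: derivableP; exact: twice_derivableW (c_C2 Dx).
exact: dT.
Qed.

Lemma is_derive_flux x k j : D x ->
  is_derive x (delta_mx ord0 j) (fun y => c (T y) * partial k n y)
    (c (T x) * partial j (partial k n) x
     + partial k n x * (derive1 c (T x) * partial j T x)).
Proof.
by move=> Dx; exact: is_deriveM (is_derive_coefficient j Dx)
  (dn k j Dx).
Qed.

Lemma div_fluxE x : D x -> div (fun y => c (T y) *: grad n y) x
  = \sum_j (c (T x) * partial j (partial j n) x
            + partial j n x * (derive1 c (T x) * partial j T x)).
Proof.
move=> Dx; apply: eq_bigr => j _.
rewrite (_ : (fun y => _) = (fun y => c (T y) * partial j n y)).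
  by case: (is_derive_flux j j Dx).
by apply/funext => y; rewrite !mxE.
Qed.

(** The gradient of the chemical potential contains third derivatives of the
    density and second derivatives of the temperature and of the influence
    parameter; this is where the three regularity hypotheses are needed. *)
Lemma derivable_div_flux x i : D x ->
  derivable (div (fun y => c (T y) *: grad n y)) x (delta_mx ord0 i).
Proof.
move=> Dx.
pose F j y := c (T y) * partial j (partial j n) y
   + partial j n y * (derive1 c (T y) * partial j T y).
have dF j : derivable (F j) x (delta_mx ord0 i).
  have [dc _] := is_derive_coefficient i Dx.
  have [djn _] := dn j i Dx.
  have djjn : derivable (partial j (partial j n)) x (delta_mx ord0 i).
    exact: of_class_derivable
      (of_class_partial j (of_class_partial j n_C3)) Dx.
  have djT : derivable (partial j T) x (delta_mx ord0 i).
    exact: of_class_derivable (of_class_partial j T_C2) Dx.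
  have dc' : derivable (fun y => derive1 c (T y)) x (delta_mx ord0 i).
    have [_ c2] := c_C2 Dx.
    by case: (is_derive_comp_scalar (derivableP c2) (dT i Dx)).
  exact: (derivableD (derivableM dc djjn)
    (derivableM djn (derivableM dc' djT))).
have dsum : derivable (\sum_j F j) x (delta_mx ord0 i).
  exact: derivable_sum.
have nD : \forall y \near x, D y by exact: open_nbhs_nbhs.
apply: near_eq_derivable dsum.
by apply: filterS nD => y Dy; rewrite fct_sumE div_fluxE.
Qed.

Lemma is_derive_sqnorm_grad x i : D x ->
  is_derive x (delta_mx ord0 i) (fun y => euclidean_sqnorm (grad n y))
    (2 * \sum_j partial j n x * partial i (partial j n) x).
Proof.
move=> Dx; rewrite mulr_sumr.
rewrite (_ : (fun y => _) = \sum_j (partial j n * partial j n)); last first.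
  apply/funext => y; rewrite fct_sumE; apply: eq_bigr => j _.
  by rewrite mxE expr2.
apply: is_derive_sum => j.
apply: is_derive_eq (is_deriveM (dn j i Dx) (dn j i Dx)) _.
by rewrite /GRing.scale /= mulr_natl mulr2n.
Qed.

(** By the product rule, component [i] of the divergence is [d_i n] times the
    divergence of [c grad n] plus [c grad n . grad (d_i n)].  Swapping the two
    derivatives in [d_j (d_i n)] turns the last term into half of [c] times
    [d_i] of the squared gradient, which is what the gradient of the pressure
    contains. *)
Lemma tensor_div_capillary x i : D x ->
  tensor_div (fun y => c (T y) *: tensor_prod (grad n y) (grad n y)) x ord0 i
  = partial i n x * div (fun y => c (T y) *: grad n y) x
    + c (T x) * \sum_j partial j n x * partial i (partial j n) x.
Proof.
move=> Dx; rewrite mxE div_fluxE // !mulr_sumr -big_split.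
apply: eq_bigr => j _.
rewrite (_ : (fun y => _)
    = partial i n * (fun y => c (T y) * partial j n y)); last first.
  apply/funext => y; rewrite !mxE big_ord1 !mxE; exact: mulrCA.
have [_ E] := is_deriveM (dn i j Dx) (is_derive_flux j j Dx).
apply: etrans E _.
rewrite (partialC j i D_open (of_classW n_C3) Dx) /GRing.scale /=.
(* The atoms are generalized so that [ring] does not compare their bodies. *)
move: (c (T x)) (derive1 c (T x)) (partial j T x) (partial i n x)
  (partial j n x) (partial i (partial j n) x) (partial j (partial j n) x).
by move=> c0 c1 Tj ni nj nij njj; ring.
Qed.

End CapillaryStress.

(** * The balance of gradients *)

Theorem theorem3p1 (R : realType) (fl : fluid R)
    (Rg_gt0 : 0 < gas_constant fl)
    (Tc_gt0 : 0 < critical_temperature fl)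
    (Pc_gt0 : 0 < critical_pressure fl)
    (d : nat) (Omega : set 'rV[R]_d) (n T : 'rV[R]_d -> R)
    (Omega_open : open Omega)
    (n_C3 : of_class 3 Omega n) (T_C2 : of_class 2 Omega T)
    (n_bounds : forall x, Omega x -> 0 < n x < 1 / pr_b fl)
    (T_gt0 : forall x, Omega x -> 0 < T x) :
  forall x, Omega x ->
    n x *: grad (mu fl n T) x - gamma fl n T x *: grad T x
    = grad (pressure fl n T) x
      + tensor_div
          (fun y => influence fl (T y) *: tensor_prod (grad n y) (grad n y)) x.
Proof.
move=> x Ox; apply/rowP => i.
pose ei : 'rV[R]_d := delta_mx ord0 i.
have c_C2 y : Omega y -> twice_derivable (influence fl) (T y).
  by move=> Oy; exact: (twice_derivable_influence Tc_gt0 (T_gt0 _ Oy)).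
set c := influence fl in c_C2 *.
have nT_near : \forall y \near x, admissible_density fl (n y) /\ 0 < T y.
  have nOmega : \forall y \near x, Omega y by exact: open_nbhs_nbhs.
  apply: filterS nOmega => y Oy.
  by split; [exact: n_bounds Oy|exact: T_gt0 Oy].
have dn : derivable n x ei := of_class_derivable n_C3 Ox.
have dT : derivable T x ei := of_class_derivable T_C2 Ox.
have dmu : derivable (mu fl n T) x ei := derivableB
  (derivable_mu_b Rg_gt0 Tc_gt0 Pc_gt0 nT_near dn dT)
  (derivable_div_flux Omega_open n_C3 T_C2 c_C2 Ox).
have dfb := is_derive_f_b Rg_gt0 Tc_gt0 Pc_gt0 nT_near
  (derivableP dn) (derivableP dT).
have dc2 : is_derive x ei (fun y => 2^-1 * c (T y))
    (2^-1 * (derive1 c (T x) * partial i T x)).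
  exact: is_deriveZ (is_derive_coefficient T_C2 c_C2 i Ox).
have dp := is_deriveB (is_deriveB
  (is_deriveM (derivableP dn) (derivableP dmu)) dfb)
  (is_deriveM dc2 (is_derive_sqnorm_grad n_C3 i Ox)).
have pE : partial i (pressure fl n T) x
    = n x * partial i (mu fl n T) x + mu fl n T x * partial i n x
      - (mu_b fl (n x) (T x) * partial i n x
         + gamma_b fl (n x) (T x) * partial i T x)
      - (2^-1 * c (T x) * (2 * \sum_j partial j n x * partial i (partial j n) x)
         + euclidean_sqnorm (grad n x)
           * (2^-1 * (derive1 c (T x) * partial i T x))).
  by case: dp.
have muE : mu fl n T x
    = mu_b fl (n x) (T x) - div (fun y => c (T y) *: grad n y) x by [].
rewrite mxE [RHS]mxE (tensor_div_capillary Omega_open n_C3 T_C2 c_C2 i Ox).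
rewrite !mxE pE muE /gamma /gamma_grad -/c.
(* What remains holds for arbitrary values of the fields and derivatives. *)
move: (\sum_j _) (euclidean_sqnorm _) (div _ x) (c (T x)) => s q g c0.
move: (derive1 c (T x) : R) (n x) (partial i (mu fl n T) x) => c1 nx mui.
move: (partial i n x) (partial i T x) (mu_b _ _ _) (gamma_b _ _ _).
by move=> ni Ti m k; field.
Qed.
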